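(* Let $D\subseteq\mathbb{R}$ be a neighborhood of a point $\alpha$, and let $f:D\to\mathbb{R}$ have sufficiently many continuous derivatives in $D$, where $\alpha$ is a simple root of $f$ (that is, $f(\alpha)=0$ and $f'(\alpha)\neq 0$). Let $A,B,P,Q,R$ be real-valued weight functions of one real variable, sufficiently differentiable near $0$, and consider the three-step iterative method $$y_n=x_n-A(t_1)\,\frac{f(x_n)}{f'(x_n)},$$ $$z_n=y_n-B(t_2)\,\frac{f(y_n)}{f[x_n,y_n]},$$ $$x_{n+1}=z_n-\{P(t_2)+Q(t_3)+R(t_4)\}\,\frac{f(z_n)}{f[y_n,z_n]},$$ where $t_1=\frac{f(x_n)}{f'(x_n)}$, $t_2=\frac{f(y_n)}{f(x_n)}$, $t_3=\frac{f(z_n)}{f(y_n)}$, $t_4=\frac{f(z_n)}{f(x_n)}$. Suppose that the weight functions satisfy - $A(0)=1$, $A'(0)=0$, $A''(0)=0$, $|A^{(3)}(0)|<+\infty$; - $B(0)=1$, $B'(0)=1$, $|B^{(3)}(0)|<+\infty$; - $R(0)=1-P(0)-Q(0)$; - $P'(0)=0$, $P''(0)=2$, $P^{(3)}(0)=6B''(0)-12$, $|P^{(4)}(0)|<+\infty$; - $Q'(0)=0$, $|Q''(0)|<+\infty$; - $R'(0)=2$, $|R''(0)|<+\infty$. Then the method has eighth-order convergence to $\alpha$.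
   Context: For $u\neq v$, $f[u,v]=\frac{f(u)-f(v)}{u-v}$ denotes the first-order divided difference of $f$. The error of the $n$-th iterate is $e_n=x_n-\alpha$. Eighth-order convergence is meant in the local (Taylor expansion) sense usual for such methods: for $x_n$ sufficiently close to $\alpha$, with $x_n\ne\alpha$ and with all quotients in the iteration step defined, the errors satisfy $e_{n+1}=K\,e_n^8+O(e_n^9)$ as $e_n\to 0$, where $K$ is a constant depending only on finitely many derivatives of $f$ at $\alpha$ and of the weight functions at $0$. *)

(* Defs.v *)
From Stdlib Require Import Reals List.
From Coquelicot Require Import Coquelicot.
Open Scope R_scope.

(* [f] is total; only its values on [D] matter.  At an interior point of [D]
   every derivative depends on those values alone, so regularity is asked there. *)
Definition class_C (N : nat) (D : R -> Prop) (f : R -> R) : Prop :=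
  forall x, locally x D -> forall k, (k <= N)%nat ->
    ex_derive_n f k x /\ continuous (Derive_n f k) x.

Definition diff_near (N : nat) (a : R) (g : R -> R) : Prop :=
  locally a (fun t => forall k, (k <= N)%nat -> ex_derive_n g k t).

Definition simple_root (f : R -> R) (alpha : R) : Prop :=
  f alpha = 0 /\ Derive f alpha <> 0.

Definition divdiff (f : R -> R) (u v : R) : R := (f u - f v) / (u - v).

(* Division is total in [R]: the conditions [f x <> 0], [x <> y], ... say that
   each quotient in the step is defined, and [D x], [D y], [D z] that [f] is. *)
Definition step (D : R -> Prop) (f A B P Q W : R -> R) (x x' : R) : Prop :=
  exists y z : R,
    let t1 := f x / Derive f x in
    let t2 := f y / f x in
    let t3 := f z / f y in
    let t4 := f z / f x in
    (D x /\ D y /\ D z) /\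
    (Derive f x <> 0 /\ f x <> 0 /\ f y <> 0) /\
    (x <> y /\ divdiff f x y <> 0 /\ y <> z /\ divdiff f y z <> 0) /\
    y = x - A t1 * (f x / Derive f x) /\
    z = y - B t2 * (f y / divdiff f x y) /\
    x' = z - (P t2 + Q t3 + W t4) * (f z / divdiff f y z).

(* e' = K e^p + O(e^(p+1)) as e -> 0, where e = x - alpha and e' = x' - alpha. *)
Definition error_expansion (next : R -> R -> Prop) (alpha : R) (p : nat) (K : R)
    : Prop :=
  exists C delta : R, 0 < delta /\
    forall x x' : R, 0 < Rabs (x - alpha) < delta -> next x x' ->
      Rabs ((x' - alpha) - K * (x - alpha) ^ p) <= C * Rabs (x - alpha) ^ S p.

Definition jet (N : nat) (g : R -> R) (a : R) : list R :=
  map (fun k => Derive_n g k a) (seq 0 (S N)).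

(* Main.v *)
Require Import Defs.
From Stdlib Require Import Reals List Factorial Lra Lia.
From Coquelicot Require Import Coquelicot.
Import ListNotations.
Open Scope R_scope.

(** Write e = x_n - alpha.  Since alpha is a simple root,
    f (alpha + u) = f1 * u * G u near 0 with f1 = f'(alpha) and
    G = 1 + c2 u + c3 u^2 + ..., where c_k = f^(k)(alpha) / (k! f1).  Substituted
    into the iteration, this makes the error of each substep a multiple of the
    error before it:
      y_n - alpha = e * eta,  z_n - alpha = (y_n - alpha) * zeta,
      x_{n+1} - alpha = (z_n - alpha) * xi,
    and eta, zeta, xi are built from G, the weight functions and each other by
    field operations and composition only.  In particular a divided difference
    f[u, v] with v - alpha = k * (u - alpha) equals
    f1 * (G(u) - k * G(v)) / (1 - k), so that no two-variable Taylor expansion is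
    involved ([secant_correction], [step_error]).

    The order then splits as 8 = 1 + 1 + 2 + 4: one factor e stands in front, and
      eta = c2 e + O(e^2),  zeta = zeta2 e^2 + O(e^3),  xi = xi4 e^4 + O(e^5),
      zeta2 = (3 - B''(0)/2) c2^2 - c3
    ([eta_expands], [zeta_expands], [xi_expands]); the conditions on the weights
    are what cancels the earlier coefficients.  Hence K = c2 * zeta2 * xi4.
    Factoring, rather than expanding the errors themselves, matters when c2 = 0:
    then y_n - alpha may be far smaller than e^2, but
    t3 = f(z_n) / f(y_n) is still O(e^2), because it is zeta * G(z) / G(y).

    The expansions are carried out modulo e^5 with lists of coefficients: the
    relation [expands] between functions and such lists respects addition,
    multiplication, inversion and composition, Taylor's theorem
    ([expands_taylor]) supplies its instances, and every cancellation
    becomes a polynomial identity. *)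

(** * Truncated expansions at 0 *)

(** A list [a0; ...; a_(n-1)] stands for a0 + ... + a_(n-1) x^(n-1) + O(x^n): its
    length is the order of the error.  Peeling off one coefficient at a time, with
    an unspecified bounded remainder at the end, lets every operation be treated by
    structural induction without estimating error terms. *)
Inductive expands : (R -> R) -> list R -> Prop :=
| expands_nil u C :
    locally 0 (fun x => Rabs (u x) <= C) -> expands u []
| expands_cons u a r l :
    locally 0 (fun x => u x = a + x * r x) -> expands r l ->
    expands u (a :: l).

Lemma locally_0_Rabs eps : 0 < eps -> locally 0 (fun x : R => Rabs x < eps).
Proof.
  intros He; exists (mkposreal eps He); intros x Hx.
  change (Rabs (x - 0) < eps) in Hx; now rewrite Rminus_0_r in Hx.
Qed.

Lemma expands_ext u v l :
  locally 0 (fun x => u x = v x) -> expands u l -> expands v l.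
Proof.
  intros E H; inversion H as [w C Hb | w a r l' Hr Hl]; subst.
  - apply expands_nil with C.
    generalize (filter_and _ _ E Hb); apply filter_imp; intros x [<- ?]; assumption.
  - apply expands_cons with r; [|assumption].
    generalize (filter_and _ _ E Hr); apply filter_imp; intros x [<- ?]; assumption.
Qed.

Lemma expands_eq u l m : expands u l -> l = m -> expands u m.
Proof. intros H <-; exact H. Qed.

Lemma expands_bounded u l :
  expands u l -> exists C, locally 0 (fun x => Rabs (u x) <= C).
Proof.
  induction 1 as [u C H | u a r l Hr _ [C HC]]; [exists C; exact H|].
  exists (Rabs a + Rabs C).
  generalize (filter_and _ _ (locally_0_Rabs 1 Rlt_0_1) (filter_and _ _ Hr HC)).
  apply filter_imp; intros x [Hx [-> Hrx]].
  eapply Rle_trans; [apply Rabs_triang|]; rewrite Rabs_mult.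
  pose proof (Rle_abs C); pose proof (Rabs_pos x); pose proof (Rabs_pos (r x)).
  nra.
Qed.

Lemma expands_tail u a l :
  expands u (a :: l) ->
  exists r, locally 0 (fun x => u x = a + x * r x) /\ expands r l.
Proof. intros H; inversion H; subst; eauto. Qed.

(** Initial zeros are an exact factor x^n, so orders of vanishing multiply. *)
Lemma expands_valuation n u l :
  expands u (repeat 0 n ++ l) ->
  exists v, locally 0 (fun x => u x = x ^ n * v x) /\ expands v l.
Proof.
  revert u; induction n as [|n IH]; simpl; intros u H.
  - exists u; split; [apply filter_forall; intros x; ring | exact H].
  - destruct (expands_tail _ _ _ H) as [r [Hr Hl]].
    destruct (IH _ Hl) as [v [Hv Hv']]; exists v; split; [|exact Hv'].
    generalize (filter_and _ _ Hr Hv); apply filter_imp.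
    intros x [-> ->]; ring.
Qed.

(** The operations on coefficient lists truncate to the shorter argument, which is
    the precision that the data warrant. *)
Fixpoint add (l m : list R) : list R :=
  match l, m with
  | a :: l', b :: m' => (a + b) :: add l' m'
  | _, _ => []
  end.

Definition scale (c : R) (l : list R) : list R := map (Rmult c) l.

Fixpoint mul (l m : list R) : list R :=
  match l, m with
  | a :: l', b :: m' => (a * b) :: add (scale a m') (mul l' m)
  | _, _ => []
  end.

(** Coefficients of 1 / (1 + x * r) up to order [n], where [l] expands [r]: the
    recursion is 1 / v = 1 - x * r / v. *)
Fixpoint inv (n : nat) (l : list R) : list R :=
  match n with
  | O => []
  | S n' => 1 :: scale (-1) (mul l (inv n' l))
  end.

(** Coefficients of g (x * s), where [l] expands [g] and [w] expands [s]; the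
    recursion is g (u) = a + u * r (u) at u = x * s. *)
Fixpoint comp (l w : list R) : list R :=
  match l with
  | [] => []
  | a :: l' => a :: mul w (comp l' w)
  end.

Lemma expands_add_nil u v l m :
  expands u l -> expands v m -> expands (fun x => u x + v x) [].
Proof.
  intros Hu Hv.
  destruct (expands_bounded _ _ Hu) as [C HC], (expands_bounded _ _ Hv) as [C' HC'].
  apply expands_nil with (C + C').
  generalize (filter_and _ _ HC HC'); apply filter_imp; intros x [H1 H2].
  eapply Rle_trans; [apply Rabs_triang | lra].
Qed.

Lemma expands_mul_nil u v l m :
  expands u l -> expands v m -> expands (fun x => u x * v x) [].
Proof.
  intros Hu Hv.
  destruct (expands_bounded _ _ Hu) as [C HC], (expands_bounded _ _ Hv) as [C' HC'].
  apply expands_nil with (C * C').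
  generalize (filter_and _ _ HC HC'); apply filter_imp; intros x [H1 H2].
  rewrite Rabs_mult; apply Rmult_le_compat; auto using Rabs_pos.
Qed.

Lemma expands_add u v l m :
  expands u l -> expands v m -> expands (fun x => u x + v x) (add l m).
Proof.
  intros Hu; revert v m; induction Hu as [u C H | u a r l Hr Hl IH]; intros v m Hv.
  - now apply expands_add_nil with [] m; [apply expands_nil with C|].
  - assert (Hu : expands u (a :: l)) by (now apply expands_cons with r).
    inversion Hv as [w C Hb | w b s m' Hs Hm]; subst.
    + now apply expands_add_nil with (a :: l) [].
    + apply expands_cons with (fun x => r x + s x); [|now apply IH].
      generalize (filter_and _ _ Hr Hs); apply filter_imp; intros x [-> ->]; ring.
Qed.

Lemma expands_scale c u l :
  expands u l -> expands (fun x => c * u x) (scale c l).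
Proof.
  induction 1 as [u C H | u a r l Hr _ IH].
  - apply expands_nil with (Rabs c * C).
    revert H; apply filter_imp; intros x Hx; rewrite Rabs_mult.
    apply Rmult_le_compat_l; auto using Rabs_pos.
  - apply expands_cons with (fun x => c * r x); [|exact IH].
    revert Hr; apply filter_imp; intros x ->; ring.
Qed.

Lemma expands_sub u v l m :
  expands u l -> expands v m ->
  expands (fun x => u x - v x) (add l (scale (-1) m)).
Proof.
  intros Hu Hv; apply expands_ext with (fun x => u x + -1 * v x).
  - apply filter_forall; intros x; ring.
  - now apply expands_add, expands_scale.
Qed.

Lemma expands_mul u v l m :
  expands u l -> expands v m -> expands (fun x => u x * v x) (mul l m).
Proof.
  intros Hu; revert v m; induction Hu as [u C H | u a r l Hr Hl IH]; intros v m Hv.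
  - now apply expands_mul_nil with [] m; [apply expands_nil with C|].
  - assert (Hu : expands u (a :: l)) by (now apply expands_cons with r).
    inversion Hv as [w C Hb | w b s m' Hs Hm]; subst.
    + now apply expands_mul_nil with (a :: l) [].
    + apply expands_cons with (fun x => a * s x + r x * v x).
      * generalize (filter_and _ _ Hr Hs); apply filter_imp.
        intros x [-> ->]; ring.
      * now apply expands_add; [apply expands_scale | apply IH].
Qed.

Lemma expands_const c n : expands (fun _ => c) (c :: repeat 0 n).
Proof.
  revert c; induction n as [|n IH]; intros c.
  - apply expands_cons with (fun _ => 0).
    + apply filter_forall; intros x; ring.
    + apply expands_nil with 0; apply filter_forall; intros _; rewrite Rabs_R0; lra.
  - apply expands_cons with (fun _ => 0); [apply filter_forall; intros x; ring | apply IH].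
Qed.

Lemma expands_shift u l : expands u l -> expands (fun x => x * u x) (0 :: l).
Proof.
  intros H; apply expands_cons with u; [|exact H].
  apply filter_forall; intros x; ring.
Qed.

Lemma expands_small u l eps :
  0 < eps -> expands u (0 :: l) -> locally 0 (fun x => Rabs (u x) < eps).
Proof.
  intros He H; inversion H as [|w a r l' Hr Hl]; subst.
  destruct (expands_bounded _ _ Hl) as [C HC].
  assert (Hd : 0 < eps / (1 + Rabs C)) by
    (apply Rdiv_lt_0_compat; [|pose proof (Rabs_pos C)]; lra).
  generalize (filter_and _ _ (locally_0_Rabs _ Hd) (filter_and _ _ Hr HC)).
  apply filter_imp; intros x [H1 [-> H2]].
  rewrite Rplus_0_l, Rabs_mult.
  pose proof (Rle_abs C); pose proof (Rabs_pos C); pose proof (Rabs_pos x).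
  apply Rle_lt_trans with (Rabs x * (1 + Rabs C)); [apply Rmult_le_compat_l; lra|].
  apply Rlt_le_trans with (eps / (1 + Rabs C) * (1 + Rabs C)).
  - apply Rmult_lt_compat_r; lra.
  - right; field; lra.
Qed.

(** Used both to compose expansions and to evaluate the local factorization of [f]
    at the errors of y_n and z_n. *)
Lemma expands_pullback u l (P : R -> Prop) :
  expands u (0 :: l) -> locally 0 P -> locally 0 (fun x => P (u x)).
Proof.
  intros H [d Hd].
  generalize (expands_small u l d (cond_pos d) H); apply filter_imp.
  intros x Hx; apply Hd; change (Rabs (u x - 0) < d); now rewrite Rminus_0_r.
Qed.

Lemma expands_comp g u l w :
  expands g l -> expands u (0 :: w) -> expands (fun x => g (u x)) (comp l w).
Proof.
  intros Hg Hu; induction Hg as [g C H | g a r l Hr Hl IH].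
  - apply expands_nil with C; exact (expands_pullback u w _ Hu H).
  - assert (Hu' := Hu); inversion Hu' as [|u' z s w' Hs Hw]; subst.
    apply expands_cons with (fun x => s x * r (u x)); [|now apply expands_mul].
    generalize (filter_and _ _ Hs (expands_pullback u w _ Hu Hr)).
    apply filter_imp; intros x [E ->]; rewrite E at 1; ring.
Qed.

(** Bounds the reciprocal in the base case of [expands_inv]. *)
Lemma expands_far v l :
  expands v (1 :: l) -> locally 0 (fun x => / 2 <= v x).
Proof.
  intros H; assert (H' : expands (fun x => v x - 1) (0 :: l)).
  { inversion H as [|w a r l' Hr Hl]; subst; apply expands_cons with r; [|assumption].
    revert Hr; apply filter_imp; intros x ->; ring. }
  assert (Hp : 0 < / 2) by lra.
  generalize (expands_small _ _ _ Hp H'); apply filter_imp; intros x Hx.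
  apply Rabs_def2 in Hx; lra.
Qed.

Lemma expands_inv n v l :
  expands v (1 :: l) -> expands (fun x => / v x) (inv n l).
Proof.
  intros H; assert (Hv := expands_far _ _ H).
  inversion H as [|w a r l' Hr Hl]; subst.
  induction n as [|n IH]; simpl.
  - apply expands_nil with 2; revert Hv; apply filter_imp; intros x Hx.
    rewrite Rabs_pos_eq by (left; apply Rinv_0_lt_compat; lra).
    rewrite <- (Rinv_inv 2); apply Rinv_le_contravar; lra.
  - apply expands_cons with (fun x => -1 * (r x * / v x)).
    + generalize (filter_and _ _ Hv Hr); apply filter_imp; intros x [Hx E].
      rewrite E in *; field; lra.
    + now apply expands_scale, expands_mul.
Qed.

Lemma expands_div n u v l m :
  expands u l -> expands v (1 :: m) ->
  expands (fun x => u x / v x) (mul l (inv n m)).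
Proof. intros Hu Hv; apply expands_mul; [exact Hu | now apply expands_inv]. Qed.

(** * Taylor's theorem *)

Fixpoint peval (l : list R) (x : R) : R :=
  match l with [] => 0 | a :: l' => a + x * peval l' x end.

(** The remainders after each coefficient come from repeated division by x.  At
    x = 0 the bound forces u 0 to be the first coefficient, and writing the quotient
    as the polynomial plus a correction gives it the right value there too. *)
Lemma expands_of_remainder u l C :
  0 <= C ->
  locally 0 (fun x => Rabs (u x - peval l x) <= C * Rabs x ^ length l) ->
  expands u l.
Proof.
  intros HC; revert u; induction l as [|a l IH]; simpl; intros u H.
  - apply expands_nil with C; revert H; apply filter_imp; intros x Hx.
    replace (u x) with (u x - 0) by ring; lra.
  - apply expands_cons
      with (fun x => peval l x + (u x - (a + x * peval l x)) / x).
    + revert H; apply filter_imp; intros x Hx.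
      destruct (Req_dec x 0) as [-> | Hx0]; [|field; exact Hx0].
      rewrite Rabs_R0 in Hx.
      assert (E : u 0 - (a + 0 * peval l 0) = 0).
      { apply Rabs_eq_0; pose proof (Rabs_pos (u 0 - (a + 0 * peval l 0))); lra. }
      lra.
    + apply IH; revert H; apply filter_imp; intros x Hx.
      set (p := peval l x) in *; set (d := u x - (a + x * p)) in *.
      replace (p + d / x - p) with (d / x) by ring.
      destruct (Req_dec x 0) as [-> | Hx0].
      * rewrite Rabs_R0 in Hx.
        assert (E : d = 0) by (apply Rabs_eq_0; pose proof (Rabs_pos d); lra).
        rewrite E; unfold Rdiv; rewrite Rmult_0_l, Rabs_R0.
        apply Rmult_le_pos; [exact HC | apply pow_le, Rle_refl].
      * pose proof (Rabs_pos_lt _ Hx0).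
        rewrite Rabs_div by exact Hx0.
        apply Rmult_le_reg_r with (Rabs x); [assumption|].
        replace (Rabs d / Rabs x * Rabs x) with (Rabs d) by (field; lra); lra.
Qed.

Lemma diff_near_le n m a g : (m <= n)%nat -> diff_near n a g -> diff_near m a g.
Proof.
  intros Hmn; unfold diff_near; apply filter_imp; intros t Ht k Hk; apply Ht; lia.
Qed.

Lemma diff_near_Derive n a g : diff_near (S n) a g -> diff_near n a (Derive g).
Proof.
  unfold diff_near; apply filter_imp; intros t Ht k Hk; specialize (Ht (S k) ltac:(lia)).
  destruct k as [|k]; [exact I|]; simpl.
  apply ex_derive_ext with (Derive_n g (S k)); [|exact Ht].
  intros s; rewrite (Derive_n_comp g k 1); now rewrite Nat.add_comm.
Qed.

Definition taylor (n : nat) (g : R -> R) (a : R) : list R :=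
  map (fun k => Derive_n g k a / INR (fact k)) (seq 0 n).

(** Taylor polynomial started at an arbitrary index [j], the form that is stable
    under differentiation. *)
Fixpoint tsum (d : nat -> R) (j n : nat) (x : R) : R :=
  match n with
  | O => 0
  | S n' => d j / INR (fact j) * x ^ j + tsum d (S j) n' x
  end.

Lemma tsum_peval d j n x :
  tsum d j n x = x ^ j * peval (map (fun k => d k / INR (fact k)) (seq j n)) x.
Proof.
  revert j; induction n as [|n IH]; intros j; simpl; [ring|].
  rewrite IH; simpl; ring.
Qed.

Lemma is_derive_tsum d j n x :
  is_derive (tsum d (S j) n) x (tsum (fun k => d (S k)) j n x).
Proof.
  revert j; induction n as [|n IH]; intros j.
  - simpl; apply @is_derive_const.
  - change (is_derive
      (fun t => d (S j) / INR (fact (S j)) * t ^ S j + tsum d (S (S j)) n t) x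
      (d (S j) / INR (fact j) * x ^ j + tsum (fun k => d (S k)) (S j) n x)).
    apply @is_derive_plus; [|apply IH].
    auto_derive; [exact I|].
    change (d (S j) / INR (S j * fact j) * (1 * (INR (S j) * x ^ j)) =
            d (S j) / INR (fact j) * x ^ j).
    rewrite mult_INR; field.
    split; [apply INR_fact_neq_0 | apply not_0_INR; lia].
Qed.

(** Induction on [n]: the Taylor polynomial of [Derive g] is the derivative of that
    of [g], and the mean value theorem gains one power of x.  This treats both sides
    of [a] at once. *)
Lemma taylor_remainder n (g : R -> R) (a : R) :
  diff_near (S n) a g ->
  exists C, 0 <= C /\ locally 0 (fun x =>
      Rabs (g (a + x) - tsum (fun k => Derive_n g k a) 0 n x) <= C * Rabs x ^ n).
Proof.
  revert g; induction n as [|n IH]; intros g H.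
  - assert (Hc : continuous g a).
    { apply @ex_derive_continuous; exact (locally_singleton _ _ H 1%nat (le_n _)). }
    exists (Rabs (g a) + 1); split; [pose proof (Rabs_pos (g a)); lra|].
    destruct (Hc (ball (g a) (mkposreal 1 Rlt_0_1)) (locally_ball _ _)) as [d Hd].
    exists d; intros x Hx; simpl.
    assert (Hg : Rabs (g (a + x) - g a) < 1).
    { apply (Hd (a + x)); change (Rabs (a + x - a) < d).
      change (Rabs (x - 0) < d) in Hx; now replace (a + x - a) with (x - 0) by ring. }
    pose proof (Rabs_triang (g (a + x) - g a) (g a)) as Ht.
    replace (g (a + x) - g a + g a) with (g (a + x)) in Ht by ring.
    rewrite Rminus_0_r; lra.
  - destruct (IH (Derive g) (diff_near_Derive _ _ _ H)) as [C [HC HR]].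
    exists C; split; [exact HC|].
    destruct HR as [d1 Hd1], H as [d2 Hd2].
    assert (Hd : 0 < Rmin d1 d2) by (apply Rmin_pos; apply cond_pos).
    exists (mkposreal _ Hd); intros x Hx.
    change (Rabs (x - 0) < Rmin d1 d2) in Hx; rewrite Rminus_0_r in Hx.
    pose proof (Rmin_l d1 d2); pose proof (Rmin_r d1 d2).
    set (T := fun t => tsum (fun k => Derive_n g k a) 0 (S n) t).
    set (dT := fun t => tsum (fun k => Derive_n (Derive g) k a) 0 n t).
    assert (Hder : forall t, Rabs t <= Rabs x ->
      is_derive (fun t => g (a + t) - T t) t (Derive g (a + t) - dT t)).
    { intros t Ht; apply @is_derive_minus.
      - assert (Hg : ex_derive g (a + t)).
        { refine (Hd2 (a + t) _ 1%nat _); [|lia].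
          change (Rabs (a + t - a) < d2); replace (a + t - a) with t by ring; lra. }
        auto_derive; [exact Hg | now rewrite !Rmult_1_l].
      - apply is_derive_ext
          with (fun t => g a + tsum (fun k => Derive_n g k a) 1 n t).
        { intros s; unfold T; simpl; field. }
        replace (dT t) with
          (plus zero (tsum (fun k => Derive_n g (S k) a) 0 n t)).
        + apply @is_derive_plus; [apply @is_derive_const|].
          apply (is_derive_tsum (fun k => Derive_n g k a)).
        + unfold plus, zero; simpl; rewrite Rplus_0_l; unfold dT; clear.
          generalize 0%nat; induction n as [|n IH]; intros j; simpl; [reflexivity|].
          rewrite IH, (Derive_n_comp g j 1), Nat.add_comm; reflexivity. }
    destruct (MVT_gen (fun t => g (a + t) - T t) 0 x
      (fun t => Derive g (a + t) - dT t)) as [c [Hc E]].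
    { intros t Ht; apply Hder; unfold Rmin, Rmax, Rabs in *.
      destruct (Rle_dec 0 x), (Rcase_abs t), (Rcase_abs x); lra. }
    { intros t Ht; apply derivable_continuous_pt.
      exists (Derive g (a + t) - dT t); apply is_derive_Reals, Hder.
      unfold Rmin, Rmax, Rabs in *.
      destruct (Rle_dec 0 x), (Rcase_abs t), (Rcase_abs x); lra. }
    assert (Hcx : Rabs c <= Rabs x).
    { unfold Rmin, Rmax, Rabs in *.
      destruct (Rle_dec 0 x), (Rcase_abs c), (Rcase_abs x); lra. }
    assert (E0 : g (a + 0) - T 0 = 0).
    { unfold T; rewrite tsum_peval; simpl; rewrite Rplus_0_r; field. }
    rewrite E0, Rminus_0_r, Rminus_0_r in E.
    change (Rabs (g (a + x) - T x) <= C * Rabs x ^ S n).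
    rewrite E, Rabs_mult.
    replace (C * Rabs x ^ S n) with (C * Rabs x ^ n * Rabs x) by (simpl; ring).
    apply Rmult_le_compat_r; [apply Rabs_pos|].
    apply Rle_trans with (C * Rabs c ^ n).
    + apply Hd1; change (Rabs (c - 0) < d1); rewrite Rminus_0_r; lra.
    + apply Rmult_le_compat_l; [exact HC|].
      apply pow_incr; split; [apply Rabs_pos | exact Hcx].
Qed.

Lemma expands_taylor n g a :
  diff_near (S n) a g -> expands (fun x => g (a + x)) (taylor n g a).
Proof.
  intros H; destruct (taylor_remainder n g a H) as [C [HC HR]].
  apply expands_of_remainder with C; [exact HC|].
  unfold taylor; rewrite length_map, length_seq.
  revert HR; apply filter_imp; intros x.
  now rewrite tsum_peval, pow_O, Rmult_1_l.
Qed.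

(** * Expansion of the three error factors *)

(** Compares coefficient lists entry by entry.  The last entry may be an
    existential variable: where the coefficient of e^4 does not influence the
    result, it is left as whatever the computation produces. *)
Ltac coefficients :=
  cbn [add mul scale inv comp map repeat app];
  repeat (apply f_equal2; [ring|]); try reflexivity.

Section ErrorFactors.

Set Implicit Arguments.

Variables G H A B P Q W : R -> R.

(** In terms of the error [e], with f (alpha + u) = f1 * u * G u and
    f' (alpha + u) = f1 * H u: [yerr] and [zerr] are the errors of y_n and z_n,
    [tau] is t2, and t1 is [e * newton e]. *)
Definition newton e := G e / H e.
Definition eta e := 1 - A (e * newton e) * newton e.
Definition yerr e := e * eta e.
Definition tau e := eta e * G (yerr e) / G e.
Definition zeta e :=
  1 - B (tau e) * (G (yerr e) * (1 - eta e) / (G e - eta e * G (yerr e))).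
Definition zerr e := yerr e * zeta e.
Definition t3 e := zeta e * G (zerr e) / G (yerr e).
Definition t4 e := t3 e * tau e.
Definition xi e :=
  1 - (P (tau e) + Q (t3 e) + W (t4 e)) *
      (G (zerr e) * (1 - zeta e) / (G (yerr e) - zeta e * G (zerr e))).

(* The hypotheses below are the expansions of G and H = G + u G', and the conditions
   of the theorem on the weights, with the derivatives divided by factorials. *)
Variables c2 c3 c4 c5 a a4 b2 b3 b4 p0 p4 q0 q2 q3 q4 r2 r3 r4 : R.

Hypothesis HG : expands G [1; c2; c3; c4; c5].
Hypothesis HH : expands H [1; 2 * c2; 3 * c3; 4 * c4; 5 * c5].
Hypothesis HA : expands A [1; 0; 0; a; a4].
Hypothesis HB : expands B [1; 1; b2; b3; b4].
Hypothesis HP : expands P [p0; 0; 1; 2 * b2 - 2; p4].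
Hypothesis HQ : expands Q [q0; 0; q2; q3; q4].
Hypothesis HW : expands W [1 - p0 - q0; 2; r2; r3; r4].

Let eta2 := 2 * c3 - 2 * c2 ^ 2.
Let eta3 := 4 * c2 ^ 3 - 7 * c2 * c3 + 3 * c4 - a.
Let zeta2 := (3 - b2) * c2 ^ 2 - c3.
Let zeta3 := (7 * b2 - b3 - 12) * c2 ^ 3 + (12 - 4 * b2) * c2 * c3 - 2 * c4 + a.
Let xi4 := (3 - 2 * b2 + 2 * b3 - p4) * c2 ^ 4 - 4 * c2 ^ 2 * c3 + c2 * c4
           - a * c2 - q2 * zeta2 ^ 2.

Lemma one_expands : expands (fun _ => 1) [1; 0; 0; 0; 0].
Proof. exact (expands_const 1 4). Qed.

Lemma eta_expands : exists k, expands eta [0; c2; eta2; eta3; k].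
Proof.
  assert (HN : exists k, expands newton
    [1; - c2; 2 * c2 ^ 2 - 2 * c3; - 4 * c2 ^ 3 + 7 * c2 * c3 - 3 * c4; k]).
  { eexists; eapply expands_eq; [exact (expands_div 5 _ _ _ _ HG HH)|].
    coefficients. }
  destruct HN as [k HN].
  eexists; eapply expands_eq.
  - apply expands_sub; [apply one_expands|].
    apply expands_mul; [|exact HN].
    exact (expands_comp _ _ _ _ HA (expands_shift _ _ HN)).
  - unfold eta2, eta3; coefficients.
Qed.

Lemma yerr_expands : expands yerr [0; 0; c2; eta2; eta3].
Proof.
  destruct eta_expands as [k He].
  eapply expands_eq.
  - refine (expands_mul (fun x => x) eta [0; 1; 0; 0; 0] _ _ He).
    apply expands_ext with (fun x => x * 1); [apply filter_forall; intros; ring|].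
    exact (expands_shift _ _ (expands_const 1 3)).
  - coefficients.
Qed.

Lemma G_yerr_expands :
  expands (fun e => G (yerr e))
    [1; 0; c2 ^ 2; c2 * eta2; c2 * eta3 + c3 * c2 ^ 2].
Proof.
  eapply expands_eq; [exact (expands_comp _ _ _ _ HG yerr_expands)|].
  coefficients.
Qed.

Lemma tau_expands :
  exists k, expands tau
    [0; c2; 2 * c3 - 3 * c2 ^ 2; 8 * c2 ^ 3 - 10 * c2 * c3 + 3 * c4 - a; k].
Proof.
  destruct eta_expands as [k He].
  eexists; eapply expands_eq.
  - exact (expands_div 5 _ _ _ _ (expands_mul _ _ _ _ He G_yerr_expands) HG).
  - unfold eta2, eta3; coefficients.
Qed.

Lemma zeta_expands : exists k, expands zeta [0; 0; zeta2; zeta3; k].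
Proof.
  destruct eta_expands as [k He], tau_expands as [k' Ht].
  assert (HD : exists k, expands (fun e => G e - eta e * G (yerr e))
    [1; 0; c3 - eta2; c4 - c2 ^ 3 - eta3; k]).
  { eexists; eapply expands_eq.
    - apply expands_sub; [exact HG|].
      exact (expands_mul _ _ _ _ He G_yerr_expands).
    - coefficients. }
  destruct HD as [k'' HD].
  eexists; eapply expands_eq.
  - apply expands_sub; [apply one_expands|].
    apply expands_mul; [exact (expands_comp _ _ _ _ HB Ht)|].
    refine (expands_div 5 _ _ _ _ _ HD).
    apply expands_mul; [exact G_yerr_expands|].
    apply expands_sub; [apply one_expands | exact He].
  - unfold eta2, eta3, zeta2, zeta3; coefficients.
Qed.

Lemma zerr_expands : expands zerr [0; 0; 0; 0; c2 * zeta2].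
Proof.
  destruct zeta_expands as [k Hz].
  eapply expands_eq; [exact (expands_mul _ _ _ _ yerr_expands Hz)|].
  coefficients.
Qed.

Lemma G_zerr_expands :
  expands (fun e => G (zerr e)) [1; 0; 0; 0; c2 ^ 2 * zeta2].
Proof.
  eapply expands_eq; [exact (expands_comp _ _ _ _ HG zerr_expands)|].
  coefficients.
Qed.

Lemma t3_expands : exists k, expands t3 [0; 0; zeta2; zeta3; k].
Proof.
  destruct zeta_expands as [k Hz].
  eexists; eapply expands_eq.
  - apply (expands_div 5 _ _ _ _ (expands_mul _ _ _ _ Hz G_zerr_expands)
      G_yerr_expands).
  - coefficients.
Qed.

Lemma t4_expands :
  expands t4 [0; 0; 0; c2 * zeta2; c2 * zeta3 + zeta2 * (2 * c3 - 3 * c2 ^ 2)].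
Proof.
  destruct tau_expands as [k Ht], t3_expands as [k' H3].
  eapply expands_eq; [exact (expands_mul _ _ _ _ H3 Ht)|].
  coefficients.
Qed.

(** With s the sum of the three weights minus 1, the numerator of xi is
    G(y) - G(z) - s * G(z) * (1 - zeta), so that order four amounts to s agreeing
    with G(y) - 1 below e^4.  This is the role of P''(0) = 2,
    P'''(0) = 6 B''(0) - 12 and R'(0) = 2: the coefficients c2^2 and c2 * eta2 of
    the sum of the weights are those of G(y). *)
Lemma xi_expands : expands xi [0; 0; 0; 0; xi4].
Proof.
  destruct zeta_expands as [k Hz], tau_expands as [k' Ht], t3_expands as [k'' H3].
  assert (HS : expands (fun e => P (tau e) + Q (t3 e) + W (t4 e))
    [1; 0; c2 ^ 2; c2 * eta2; c2 * eta3 + c3 * c2 ^ 2 - xi4]).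
  { eapply expands_eq.
    - apply expands_add; [apply expands_add|].
      + exact (expands_comp _ _ _ _ HP Ht).
      + exact (expands_comp _ _ _ _ HQ H3).
      + exact (expands_comp _ _ _ _ HW t4_expands).
    - unfold xi4, zeta2, zeta3, eta2, eta3; coefficients. }
  (* Here the coefficient of e^4 has to be tracked: the unknown [k] of zeta occurs
     in numerator and denominator and cancels. *)
  assert (HD : expands (fun e => G (yerr e) - zeta e * G (zerr e))
    [1; 0; c2 ^ 2 - zeta2; c2 * eta2 - zeta3; c2 * eta3 + c3 * c2 ^ 2 - k]).
  { eapply expands_eq.
    - apply expands_sub; [exact G_yerr_expands|].
      exact (expands_mul _ _ _ _ Hz G_zerr_expands).
    - coefficients. }
  eapply expands_eq.
  - apply expands_sub; [apply one_expands|].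
    apply expands_mul; [exact HS|].
    refine (expands_div 5 _ _ _ _ _ HD).
    apply expands_mul; [exact G_zerr_expands|].
    apply expands_sub; [apply one_expands | exact Hz].
  - coefficients.
Qed.

Unset Implicit Arguments.

End ErrorFactors.

(** * From the iteration to the error factors *)

Definition error_constant (jf jA jB jP jQ jW : list R) : R :=
  let d (j : list R) (k : nat) := nth k j 0 / INR (fact k) in
  let c k := d jf k / d jf 1%nat in
  let zeta2 := (3 - d jB 2%nat) * c 2%nat ^ 2 - c 3%nat in
  let xi4 :=
    (3 - 2 * d jB 2%nat + 2 * d jB 3%nat - d jP 4%nat) * c 2%nat ^ 4
    - 4 * c 2%nat ^ 2 * c 3%nat + c 2%nat * c 4%nat
    - d jA 3%nat * c 2%nat - d jQ 2%nat * zeta2 ^ 2 in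
  c 2%nat * zeta2 * xi4.

(** A divided difference at alpha + s and alpha + s * k becomes a one-variable
    expression in the ratio k of the two errors; both secant substeps have this
    shape, with k = eta and k = zeta. *)
Lemma secant_correction f alpha f1 s k g g' :
  f1 <> 0 -> s <> 0 ->
  f (alpha + s) = f1 * (s * g) -> f (alpha + s * k) = f1 * (s * k * g') ->
  alpha + s <> alpha + s * k ->
  divdiff f (alpha + s) (alpha + s * k) <> 0 ->
  f (alpha + s * k) / divdiff f (alpha + s) (alpha + s * k) =
  s * k * (g' * (1 - k) / (g - k * g')).
Proof.
  intros Hf1 Hs Hu Hv Huv Hd; unfold divdiff in *; rewrite Hu, Hv in *.
  assert (Hk : 1 - k <> 0).
  { intros E; apply Huv; replace k with 1 by lra; ring. }
  assert (Hg : g - k * g' <> 0).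
  { intros E; apply Hd.
    replace (f1 * (s * g) - f1 * (s * k * g')) with (f1 * s * (g - k * g')) by ring.
    rewrite E; unfold Rdiv; ring. }
  replace (alpha + s - (alpha + s * k)) with (s * (1 - k)) by ring.
  replace (f1 * (s * g) - f1 * (s * k * g')) with (f1 * s * (g - k * g')) by ring.
  field; auto.
Qed.

Lemma step_error D f A B P Q W G H alpha f1 e x' :
  f1 <> 0 -> e <> 0 ->
  f (alpha + e) = f1 * (e * G e) ->
  Derive f (alpha + e) = f1 * H e ->
  (let y := yerr G H A e in f (alpha + y) = f1 * (y * G y)) ->
  (let z := zerr G H A B e in f (alpha + z) = f1 * (z * G z)) ->
  step D f A B P Q W (alpha + e) x' ->
  x' - alpha = e * eta G H A e * zeta G H A B e * xi G H A B P Q W e.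
Proof.
  intros Hf1 He Hx Hdx Hy Hz [y [z [_ [[Hn1 [Hn2 Hn3]] [[Hn4 [Hn5 [Hn6 Hn7]]]
    [Ey [Ez Ex]]]]]]].
  assert (Hh : H e <> 0) by (intros E; apply Hn1; rewrite Hdx, E; ring).
  assert (Hg : G e <> 0) by (intros E; apply Hn2; rewrite Hx, E; ring).
  assert (Y : y = alpha + e * eta G H A e).
  { rewrite Ey, Hx, Hdx; unfold eta, newton.
    replace (f1 * (e * G e) / (f1 * H e)) with (e * (G e / H e)) by (field; auto).
    ring. }
  clear Ey; subst y.
  cbv zeta in Hy, Hz; unfold zerr in Hz; unfold yerr in Hy, Hz.
  unfold xi, t4, t3, zerr.
  assert (Et : f (alpha + e * eta G H A e) / f (alpha + e) = tau G H A e).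
  { rewrite Hx, Hy; unfold tau, yerr; field; auto. }
  rewrite Et in Ez, Ex.
  assert (Hye : e * eta G H A e <> 0) by (intros E; apply Hn3; rewrite Hy, E; ring).
  assert (Hgy : G (e * eta G H A e) <> 0) by (intros E; apply Hn3; rewrite Hy, E; ring).
  rewrite (secant_correction f alpha f1 e _ _ _ Hf1 He Hx Hy Hn4 Hn5) in Ez.
  assert (Z : z = alpha + e * eta G H A e * zeta G H A B e).
  { rewrite Ez; unfold zeta, yerr; ring. }
  clear Ez; subst z.
  rewrite (secant_correction f alpha f1 _ _ _ _ Hf1 Hye Hy Hz Hn6 Hn7) in Ex.
  fold (yerr G H A e) in *.
  set (Y := yerr G H A e) in *; set (k := zeta G H A B e) in *.
  assert (E3 : f (alpha + Y * k) / f (alpha + Y) = k * G (Y * k) / G Y).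
  { rewrite Hy, Hz; field; auto. }
  assert (E4 : f (alpha + Y * k) / f (alpha + e) = k * G (Y * k) / G Y * tau G H A e).
  { rewrite <- E3, <- Et; field; split; assumption. }
  rewrite E3, E4 in Ex; rewrite Ex; ring.
Qed.

Lemma taylor_5 g a :
  taylor 5 g a = [g a; Derive_n g 1 a; Derive_n g 2 a / INR (fact 2);
    Derive_n g 3 a / INR (fact 3); Derive_n g 4 a / INR (fact 4)].
Proof.
  unfold taylor; cbn [map seq]; repeat (apply f_equal2; [simpl; field|]); reflexivity.
Qed.

Lemma class_C_diff_near N D f a : locally a D -> class_C N D f -> diff_near N a f.
Proof.
  intros HD Hf; unfold diff_near; generalize (locally_locally _ _ HD); apply filter_imp.
  intros t Ht k Hk; exact (proj1 (Hf t Ht k Hk)).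
Qed.

Lemma expands_weight g : diff_near 7 0 g ->
  expands g [g 0; Derive_n g 1 0; Derive_n g 2 0 / INR (fact 2);
    Derive_n g 3 0 / INR (fact 3); Derive_n g 4 0 / INR (fact 4)].
Proof.
  intros Hg; rewrite <- taylor_5.
  apply expands_ext with (fun x => g (0 + x)).
  - apply filter_forall; intros x; now rewrite Rplus_0_l.
  - apply expands_taylor, diff_near_le with 7%nat; [lia | exact Hg].
Qed.

(** G is the remainder after the vanishing first coefficient of f, divided by f1.
    The coefficient of u^k in f' / f1 is (k + 1) c_(k+1). *)
Lemma simple_root_factor f alpha :
  diff_near 7 alpha f -> simple_root f alpha ->
  let f1 := Derive f alpha in
  let c k := Derive_n f k alpha / INR (fact k) / (f1 / INR (fact 1)) in
  exists G H,
    locally 0 (fun u => f (alpha + u) = f1 * (u * G u)) /\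
    (forall u, Derive f (alpha + u) = f1 * H u) /\
    expands G [1; c 2%nat; c 3%nat; c 4%nat; c 5%nat] /\
    expands H [1; 2 * c 2%nat; 3 * c 3%nat; 4 * c 4%nat; 5 * c 5%nat].
Proof.
  intros Hf [H0 H1]; cbv zeta; set (f1 := Derive f alpha) in *.
  assert (HT : expands (fun u => f (alpha + u)) (taylor 6 f alpha)).
  { apply expands_taylor; exact Hf. }
  unfold taylor in HT; cbn [map seq] in HT.
  destruct (expands_tail _ _ _ HT) as [r [Er Hr]].
  assert (HT' : expands (fun u => Derive f (alpha + u)) (taylor 5 (Derive f) alpha)).
  { apply expands_taylor, diff_near_Derive; exact Hf. }
  rewrite taylor_5 in HT'.
  exists (fun u => / f1 * r u), (fun u => / f1 * Derive f (alpha + u)).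
  split; [|split; [|split]].
  - revert Er; apply filter_imp; intros u ->; simpl; rewrite H0; field; exact H1.
  - intros u; field; exact H1.
  - eapply expands_eq; [apply expands_scale, Hr|].
    cbn [scale map]; change (Derive_n f 1 alpha) with f1.
    generalize (Derive_n f 2 alpha), (Derive_n f 3 alpha),
      (Derive_n f 4 alpha), (Derive_n f 5 alpha); intros.
    repeat (apply f_equal2; [simpl; field; exact H1|]); reflexivity.
  - eapply expands_eq; [apply expands_scale, HT'|].
    cbn [scale map]; fold f1.
    rewrite !(Derive_n_comp f _ 1); cbn [Nat.add].
    generalize (Derive_n f 2 alpha), (Derive_n f 3 alpha),
      (Derive_n f 4 alpha), (Derive_n f 5 alpha); intros.
    repeat (apply f_equal2; [simpl; field; exact H1|]); reflexivity.
Qed.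

(* "Sufficiently many" derivatives: some order [N] suffices for all data.  The
   constant is a fixed function [K] of derivatives of order at most [N].  A bound
   |g^(k)(0)| < +oo is the existence of a (real) k-th derivative at 0. *)
Theorem theorem2p1 :
  exists (N : nat)
    (K : list R -> list R -> list R -> list R -> list R -> list R -> R),
  forall (D : R -> Prop) (alpha : R) (f wA wB wP wQ wR : R -> R),
    locally alpha D ->
    class_C N D f ->
    simple_root f alpha ->
    diff_near N 0 wA -> diff_near N 0 wB -> diff_near N 0 wP ->
    diff_near N 0 wQ -> diff_near N 0 wR ->
    (wA 0 = 1 /\ Derive_n wA 1 0 = 0 /\ Derive_n wA 2 0 = 0 /\
       ex_derive_n wA 3 0) ->
    (wB 0 = 1 /\ Derive_n wB 1 0 = 1 /\ ex_derive_n wB 3 0) ->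
    wR 0 = 1 - wP 0 - wQ 0 ->
    (Derive_n wP 1 0 = 0 /\ Derive_n wP 2 0 = 2 /\
       Derive_n wP 3 0 = 6 * Derive_n wB 2 0 - 12 /\ ex_derive_n wP 4 0) ->
    (Derive_n wQ 1 0 = 0 /\ ex_derive_n wQ 2 0) ->
    (Derive_n wR 1 0 = 2 /\ ex_derive_n wR 2 0) ->
    error_expansion (step D f wA wB wP wQ wR) alpha 8
      (K (jet N f alpha) (jet N wA 0) (jet N wB 0)
         (jet N wP 0) (jet N wQ 0) (jet N wR 0)).
Proof.
  exists 7%nat, error_constant.
  intros D alpha f A B P Q W HD Hf Hroot HA HB HP HQ HW
    [A0 [A1 [A2 _]]] [B0 [B1 _]] W0 [P1 [P2 [P3 _]]] [Q1 _] [W1 _].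
  apply class_C_diff_near with (a := alpha) in Hf; [|exact HD].
  destruct (simple_root_factor f alpha Hf Hroot) as [G [H [Ef [Edf [HG HH]]]]].
  apply expands_weight in HA, HB, HP, HQ, HW.
  rewrite A0, A1, A2 in HA; rewrite B0, B1 in HB; rewrite P1, P2, P3 in HP.
  rewrite Q1 in HQ; rewrite W0, W1 in HW.
  replace (0 / INR (fact 2)) with 0 in HA by (simpl; field).
  replace (2 / INR (fact 2)) with 1 in HP by (simpl; field).
  replace ((6 * Derive_n B 2 0 - 12) / INR (fact 3))
    with (2 * (Derive_n B 2 0 / INR (fact 2)) - 2) in HP by (simpl; field).
  destruct (eta_expands HG HH HA) as [k1 Heta].
  destruct (zeta_expands HG HH HA HB) as [k2 Hzeta].
  (* x' - alpha = e * (e v1) * (e^2 v2) * (e^4 v4). *)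
  destruct (expands_valuation 1 _ _ Heta) as [v1 [Ev1 Hv1]].
  destruct (expands_valuation 2 _ _ Hzeta) as [v2 [Ev2 Hv2]].
  destruct (expands_valuation 4 _ [_] (xi_expands HG HH HA HB HP HQ HW)) as [v4 [Ev4 Hv4]].
  destruct (expands_tail _ _ _ (expands_mul _ _ _ _ (expands_mul _ _ _ _ Hv1 Hv2) Hv4))
    as [r [Er Hr]].
  destruct (expands_bounded _ _ Hr) as [C HC].
  pose proof (expands_pullback _ _ _
    (yerr_expands HG HH HA) Ef) as Efy.
  pose proof (expands_pullback _ _ _
    (zerr_expands HG HH HA HB) Ef) as Efz.
  destruct (filter_and _ _ (filter_and _ _ Ef (filter_and _ _ Efy Efz))
    (filter_and _ _ (filter_and _ _ Ev1 (filter_and _ _ Ev2 Ev4))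
      (filter_and _ _ Er HC))) as [d Hd].
  exists C, d; split; [apply cond_pos|]; intros x x' [Hx0 Hxd] Hstep.
  set (e := x - alpha) in *.
  assert (He : e <> 0) by (intros E; rewrite E, Rabs_R0 in Hx0; lra).
  replace x with (alpha + e) in Hstep by (unfold e; ring).
  destruct (Hd e) as [[F0 [Fy Fz]] [[E1 [E2 E4]] [E0 HCe]]].
  { change (Rabs (e - 0) < d); now rewrite Rminus_0_r. }
  rewrite (step_error _ _ _ _ _ _ _ _ _ _ _ _ _ (proj2 Hroot) He F0 (Edf e)
    Fy Fz Hstep), E1, E2, E4.
  match type of E0 with _ = ?K + _ => set (K0 := K) in E0 end.
  change (error_constant _ _ _ _ _ _) with K0.
  replace (e * (e ^ 1 * v1 e) * (e ^ 2 * v2 e) * (e ^ 4 * v4 e))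
    with (e ^ 8 * (v1 e * v2 e * v4 e)) by ring.
  rewrite E0.
  replace (e ^ 8 * (K0 + e * r e) - K0 * e ^ 8) with (r e * e ^ 9) by ring.
  rewrite Rabs_mult, RPow_abs.
  apply Rmult_le_compat_r; [apply Rabs_pos | exact HCe].
Qed.
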